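(* Let $(\Omega,\Sigma,\mu)$ be a measure space and let $\Phi:\Omega\times[0,\infty)\to\mathbb{R}$. If $\Phi$ is an $E$-Orlicz function, then $\Phi$ is an $E$-Young function.
   Context: Let $(\Omega,\Sigma,\mu)$ be a measure space and $\Phi:\Omega\times[0,\infty)\to\mathbb{R}$. $\Phi$ is an $E$-Orlicz function if there exists a map $E:\Omega\times[0,\infty)\to\Omega\times[0,\infty)$ such that: for $\mu$-a.e. $t\in\Omega$, the function $u\mapsto\Phi(E(t,u))$ is convex on $[0,\infty)$, $\Phi(E(t,0))=0$, $\Phi(E(t,u))>0$ for all $u\in(0,\infty)$, $\lim_{u\to\infty}\Phi(E(t,u))=\infty$, and $u\mapsto\Phi(E(t,u))$ is left continuous at $U_\Phi=\sup\{u>0:\Phi(E(t,u))<+\infty\}$ (when $U_\Phi=+\infty$, this means $\lim_{u\to\infty}\Phi(E(t,u))=+\infty$); and for each $u\in[0,\infty)$ the function $t\mapsto\Phi(E(t,u))$ is $\mu$-measurable on $\Omega$. $\Phi$ is an $E$-Young function if there exists a map $E:\Omega\times[0,\infty)\to\Omega\times[0,\infty)$ such that: for $\mu$-a.e. $t\in\Omega$, the function $u\mapsto\Phi(E(t,u))$ is convex on $[0,\infty)$, $\Phi(E(t,0))=\lim_{u\to0^+}\Phi(E(t,u))=0$, and $\lim_{u\to\infty}\Phi(E(t,u))=\infty$; and for each $u\in[0,\infty)$ the function $t\mapsto\Phi(E(t,u))$ is $\mu$-measurable on $\Omega$. *)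

(* Defs.v *)
From mathcomp Require Import all_boot all_order all_algebra.
From mathcomp Require Import all_classical all_reals all_analysis.

Set Implicit Arguments.
Unset Strict Implicit.
Unset Printing Implicit Defensive.

Import Order.TTheory GRing.Theory Num.Theory.
Import numFieldNormedType.Exports.

Local Open Scope classical_set_scope.
Local Open Scope ring_scope.

(* u |-> Phi (E (t, u)), extended from [0, +oo[ to R as an even function so
   that convexity and limits are those of functions on R; only its values on
   [0, +oo[ are ever used below. *)
Definition E_section (R : realType) (T : Type) (Phi : T * {nonneg R} -> R)
    (E : T * {nonneg R} -> T * {nonneg R}) (t : T) : R -> R :=
  fun u => Phi (E (t, `|u|%:nng)).

Definition U_sup (R : realType) (f : R -> R) : \bar R :=
  ereal_sup [set u%:E | u in [set u | 0 < u /\ ((f u)%:E < +oo)%E]].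

Definition left_continuous_at_U_sup (R : realType) (f : R -> R) : Prop :=
  (forall r : R, U_sup f = r%:E -> f u @[u --> r^'-] --> f r) /\
  (U_sup f = +oo%E -> f u @[u --> +oo] --> +oo).

Definition E_Orlicz (R : realType) (d : measure_display)
    (T : measurableType d) (mu : {measure set T -> \bar R})
    (Phi : T * {nonneg R} -> R) : Prop :=
  exists E : T * {nonneg R} -> T * {nonneg R},
    {ae mu, forall t, let f := E_section Phi E t in
      [/\ convex_function (`[0, +oo[%classic : set R) f,
          f 0 = 0,
          forall u, 0 < u -> 0 < f u,
          f u @[u --> +oo] --> +oo
        & left_continuous_at_U_sup f]} /\
    forall u : {nonneg R}, measurable_fun [set: T] (fun t => Phi (E (t, u))).

Definition E_Young (R : realType) (d : measure_display)
    (T : measurableType d) (mu : {measure set T -> \bar R})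
    (Phi : T * {nonneg R} -> R) : Prop :=
  exists E : T * {nonneg R} -> T * {nonneg R},
    {ae mu, forall t, let f := E_section Phi E t in
      [/\ convex_function (`[0, +oo[%classic : set R) f,
          f 0 = 0,
          f u @[u --> 0^'+] --> 0
        & f u @[u --> +oo] --> +oo]} /\
    forall u : {nonneg R}, measurable_fun [set: T] (fun t => Phi (E (t, u))).

(* Main.v *)
Require Import Defs.
From mathcomp Require Import all_boot all_order all_algebra.
From mathcomp Require Import all_classical all_reals all_analysis.

Import Order.TTheory GRing.Theory Num.Theory.
Import numFieldNormedType.Exports.

Local Open Scope classical_set_scope.
Local Open Scope ring_scope.

(** The two notions differ in one point: an E-Young function has sections that
    tend to [0] at the right of [0].  A convex section vanishing at [0] lies
    below its chord from [0] to [1] ([convex_le_chord01]) and a positive one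
    lies above [0], so it is squeezed between [0] and [u * f 1]
    ([convex_ge0_cvg_at_right0]).  The other clauses carry over with the same
    map [E] and the same null set. *)

(** The point [u] is the convex combination of [1] and [0] with weight [u]. *)
Lemma convex_le_chord01 {R : realType} {f : R -> R} {u : R} :
  convex_function (`[0, +oo[%classic : set R) f -> f 0 = 0 ->
  0 <= u -> u <= 1 -> f u <= u * f 1.
Proof.
move=> f_convex f0 u_ge0 u_le1.
have in_halfline (x : R) : 0 <= x -> x \in (`[0, +oo[%classic : set R).
  by move=> x_ge0; rewrite inE /= in_itv /= x_ge0.
have : f (u * 1 + (1 - u) * 0) <= u * f 1 + (1 - u) * f 0.
  exact: (f_convex (Itv01 u_ge0 u_le1) _ _
    (in_halfline 1 ler01) (in_halfline 0 (lexx 0))).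
by rewrite f0 !mulr0 !addr0 mulr1.
Qed.

(** Convexity alone gives no continuity at the endpoint of the half-line, where
    the value of a convex function may exceed its right limit; as this value is
    [0], the chord bounds the limit from above by [0], and it is
    nonnegativity that excludes a negative limit. *)
Lemma convex_ge0_cvg_at_right0 {R : realType} {f : R -> R} :
  convex_function (`[0, +oo[%classic : set R) f -> f 0 = 0 ->
  (forall u, 0 < u -> 0 <= f u) -> f u @[u --> 0^'+] --> 0.
Proof.
move=> f_convex f0 f_ge0.
apply: (@squeeze_cvgr _ _ _ _ (cst 0) (fun u => u * f 1)).
- near=> u.
  have u_gt0 : 0 < u by near: u; exact: nbhs_right_gt.
  have u_le1 : u <= 1 by near: u; apply: nbhs_right_ltW; exact: ltr01.
  by rewrite f_ge0//= convex_le_chord01// ltW.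
- exact: cvg_cst.
- apply: cvg_at_right_filter; rewrite -[X in _ --> X](mul0r (f 1)).
  by apply: cvgMl; exact: cvg_id.
Unshelve. all: by end_near. Qed.

Theorem theorem58 (R : realType) (d : measure_display) (T : measurableType d)
  (mu : {measure set T -> \bar R}) (Phi : T * {nonneg R} -> R) :
  E_Orlicz mu Phi -> E_Young mu Phi.
Proof.
move=> [E [sections_Orlicz Phi_meas]]; exists E; split=> //.
apply: filterS sections_Orlicz => t /= [f_convex f0 f_gt0 f_cvgy _].
split=> //; apply: convex_ge0_cvg_at_right0 => // u u_gt0.
exact/ltW/f_gt0.
Qed.
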